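(* Let $r \ge 2$, $t \ge 2$ and $k \ge 1$ be integers with $k \ge t-3$. Let $G$ be a graph on $n$ vertices, where $$(r-1)(t-1)k < n \le (r-1)(t-1)(k+1),$$ and suppose $$\delta(G) \ge n - \left\lceil \frac{k}{k+1}\left\lceil \frac{n}{r-1}\right\rceil \right\rceil.$$ Then $G \rightarrow (K_r, P_t)$; that is, for every colouring of the edges of $G$ with the two colours red and blue, there is either a red copy of $K_r$ (a complete graph on $r$ vertices all of whose edges are red) or a blue copy of $P_t$ (a path on $t$ vertices all of whose edges are blue).
   Context: $\delta(G)$ denotes the minimum degree of $G$. $K_r$ is the complete graph on $r$ vertices and $P_t$ is the path on $t$ vertices. The notation $G \rightarrow (K_r,P_t)$ means every red/blue edge-colouring of $G$ contains a red $K_r$ or a blue $P_t$ as a subgraph. *)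

(* Defs.v *)
From mathcomp Require Import all_boot.
Set Implicit Arguments. Unset Strict Implicit. Unset Printing Implicit Defensive.

Definition simple_graph (T : finType) (e : rel T) : Prop :=
  symmetric e /\ irreflexive e.

Definition nbhd (T : finType) (e : rel T) (v : T) : {set T} := [set u | e v u].

Definition min_deg_ge (T : finType) (e : rel T) (d : nat) : Prop :=
  forall v : T, d <= #|nbhd e v|.

Definition ceil_div (a b : nat) : nat := (a + b.-1) %/ b.

(* A red/blue edge-colouring: the colour of edge {x,y} is red iff red x y,
   blue otherwise.  red must be symmetric so colours are edge-well-defined. *)
Definition colouring (T : finType) (red : rel T) : Prop := symmetric red.

Definition has_red_clique (T : finType) (e red : rel T) (r : nat) : Prop :=
  exists S : {set T}, #|S| = r /\
    {in S &, forall x y, x != y -> e x y && red x y}.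

Definition has_blue_path (T : finType) (e red : rel T) (t : nat) : Prop :=
  exists p : 'I_t -> T, injective p /\
    forall (i j : 'I_t), val j = (val i).+1 -> e (p i) (p j) && ~~ red (p i) (p j).

Definition arrows (T : finType) (e : rel T) (r t : nat) : Prop :=
  forall red : rel T, colouring red ->
    has_red_clique e red r \/ has_blue_path e red t.

(* Main.v *)
(** Call two vertices h-related when they are equal or not joined by a red edge,
    so that red cliques are h-stable sets, and put q = ceil (n / (r - 1)) - 1, so
    that n > (r - 1) q.  Assuming there is no blue P_t, every set S with more
    than j q vertices contains a stable set of size j + 1, by induction on j:
    picking a vertex of least blue degree in S discards at most q vertices,
    except when the blue graph on S is a disjoint union of K_(t-1), all closed
    h-neighbourhoods have q + 1 vertices, |S| = j q + 1, and t - 1 does not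
    divide q + 1.  In that case a variant of Brooks' theorem applies: if S had no
    stable set of size j + 1, every nonempty stable I would satisfy
    |N[I]| >= |I| q + 1, which forces h-triangles to consist of twins; then each
    closed h-neighbourhood is a union of blue cliques, so t - 1 divides q + 1.
    For t = 3 the blue cliques contain no triangle, but then q is even, whereas
    |S| = j q + 1 is even because S is a union of disjoint blue edges. *)
Require Import Defs.
From mathcomp Require Import all_boot zify.
Set Implicit Arguments. Unset Strict Implicit. Unset Printing Implicit Defensive.

(** * Stable sets and neighbourhoods of a reflexive symmetric relation *)

Section StableSets.
Variables (T : finType) (h : rel T).
Implicit Types (S U V I J : {set T}).

Definition stable I := [forall x in I, forall y in I, (x != y) ==> ~~ h x y].

Definition has_stable U i :=
  [exists I : {set T}, [&& I \subset U, stable I & #|I| == i]].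

Definition cnbhd S v := [set u in S | h v u].

Definition cnbhds S I := [set u in S | [exists v in I, h v u]].

Lemma stableP I : reflect {in I &, forall x y, x != y -> ~~ h x y} (stable I).
Proof.
apply: (iffP idP) => [/forall_inP H x y xI yI xy | H].
  by have /forall_inP/(_ y yI)/implyP := H x xI; apply.
by apply/forall_inP => x xI; apply/forall_inP => y yI; apply/implyP; exact: H.
Qed.

Lemma has_stableP U i :
  reflect (exists I : {set T}, [/\ I \subset U, stable I & #|I| = i])
          (has_stable U i).
Proof.
apply: (iffP existsP) => [[I /and3P[sIU sI /eqP cI]]|[I [sIU sI cI]]].
  by exists I.
by exists I; apply/and3P; split => //; apply/eqP.
Qed.

Lemma stable_sub I U : I \subset U -> stable U -> stable I.
Proof.
move=> /subsetP sIU /stableP sU; apply/stableP => x y xI yI.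
by apply: sU; apply: sIU.
Qed.

Lemma has_stable_leq U i i' : i' <= i -> has_stable U i -> has_stable U i'.
Proof.
move=> lii /has_stableP[I [sIU sI cI]]; apply/has_stableP.
exists [set x in take i' (enum I)].
have sub : [set x in take i' (enum I)] \subset I.
  by apply/subsetP => x; rewrite inE => /mem_take; rewrite mem_enum.
split; [exact: subset_trans sub sIU | exact: stable_sub sub sI |].
rewrite cardsE (card_uniqP _) ?take_uniq ?enum_uniq //.
by rewrite size_take -cardE cI; case: ltnP => //; lia.
Qed.

Hypothesis h_refl : reflexive h.
Hypothesis h_sym : symmetric h.

Lemma cnbhds1 S v : cnbhds S [set v] = cnbhd S v.
Proof.
apply/setP => u; rewrite !inE; congr (_ && _).
apply/exists_inP/idP => [[w]|hvu]; first by rewrite inE => /eqP->.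
by exists v; rewrite ?inE.
Qed.

Lemma cnbhdsU1 S v I : cnbhds S (v |: I) = cnbhd S v :|: cnbhds S I.
Proof.
apply/setP => u; rewrite !inE -andb_orr; congr (_ && _).
apply/exists_inP/orP => [[w]|[hvu|/exists_inP[w wI hwu]]].
- by rewrite !inE => /orP[/eqP->|wI hwu]; [left | right; apply/exists_inP; exists w].
- by exists v; rewrite ?inE ?eqxx.
- by exists w; rewrite ?inE ?wI ?orbT.
Qed.

Lemma cnbhds_sub S I : cnbhds S I \subset S.
Proof. by apply/subsetP => x; rewrite inE => /andP[]. Qed.

Lemma stable_union I J :
  {in I & J, forall x y, ~~ h x y} -> stable I -> stable J ->
  stable (I :|: J) /\ #|I :|: J| = #|I| + #|J|.
Proof.
move=> IJ /stableP sI /stableP sJ; split.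
  apply/stableP => x y; rewrite !inE => /orP[xI|xJ] /orP[yI|yJ] xy.
  - exact: sI.
  - exact: IJ.
  - by rewrite h_sym; exact: IJ.
  - exact: sJ.
rewrite cardsU (_ : I :&: J = set0) ?cards0 ?subn0 //.
apply/setP => x; rewrite !inE; apply/negP => /andP[xI xJ].
by have := IJ x x xI xJ; rewrite h_refl.
Qed.

Lemma has_stable_union S U V i j :
  U \subset S -> V \subset S -> {in U & V, forall x y, ~~ h x y} ->
  has_stable U i -> has_stable V j -> has_stable S (i + j).
Proof.
move=> US VS UV /has_stableP[I [IU sI <-]] /has_stableP[J [JV sJ <-]].
have IJ : {in I & J, forall x y, ~~ h x y}.
  by move=> x y xI yJ; apply: UV; [apply: (subsetP IU)|apply: (subsetP JV)].
have [sIJ <-] := stable_union IJ sI sJ.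
apply/has_stableP; exists (I :|: J); split => //.
by rewrite subUset (subset_trans IU US) (subset_trans JV VS).
Qed.

Lemma stable_extend S I : I \subset S -> stable I -> forall i,
  has_stable (S :\: cnbhds S I) i -> has_stable S (#|I| + i).
Proof.
move=> IS sI i; apply: (has_stable_union (U := I)); first exact: IS.
- exact: subsetDl.
- move=> x y xI; rewrite !inE => /andP[+ yS]; rewrite yS /=.
  by apply: contra => hxy; apply/exists_inP; exists x.
- by apply/has_stableP; exists I.
Qed.

(** * The extremal case: |S| = j q + 1 without a stable set of size j + 1 *)

Section Tight.
Variables (S : {set T}) (j q : nat).
Hypothesis cardS : #|S| = j * q + 1.
Hypothesis IH : forall i U, i < j -> U \subset S -> i * q < #|U| ->
  has_stable U i.+1.
Hypothesis deg_le : {in S, forall v, #|cnbhd S v| <= q.+1}.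
Hypothesis no_stable : ~~ has_stable S j.+1.

Lemma stable_card_le I : I \subset S -> stable I -> #|I| <= j.
Proof.
move=> IS sI; rewrite leqNgt; apply: contra no_stable => lt.
by apply: has_stable_leq lt _; apply/has_stableP; exists I.
Qed.

(** Otherwise more than (j - |I|) q vertices of [S] lie outside N[I], and a stable set given there
    by [IH] completes [I] to size j + 1. *)
Lemma cnbhds_card_ge I : I \subset S -> stable I -> 0 < #|I| ->
  #|I| * q < #|cnbhds S I|.
Proof.
move=> IS sI I0; have Ij := stable_card_le IS sI.
rewrite ltnNge; apply: contra no_stable => le.
have -> : j.+1 = #|I| + (j - #|I|).+1 by lia.
apply: stable_extend => //; apply: IH; rewrite ?subsetDl //; first by lia.
rewrite cardsD (setIidPr (cnbhds_sub S I)) cardS mulnBl.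
have := leq_mul Ij (leqnn q); lia.
Qed.

Lemma cnbhd_card v : v \in S -> #|cnbhd S v| = q.+1.
Proof.
move=> vS; apply/eqP; rewrite eqn_leq deg_le //=.
have := @cnbhds_card_ge [set v]; rewrite cnbhds1 cards1 mul1n; apply => //.
  by rewrite sub1set.
by apply/stableP => x y; rewrite !inE => /eqP-> /eqP->; rewrite eqxx.
Qed.

(** The case of equality in [cnbhds_card_ge]. *)
Definition tight I :=
  [&& I \subset S, stable I, 0 < #|I| & #|cnbhds S I| == #|I| * q + 1].

Lemma tight1 v : v \in S -> tight [set v].
Proof.
move=> vS; apply/and4P; split; rewrite ?sub1set ?cards1 //.
  by apply/stableP => x y; rewrite !inE => /eqP-> /eqP->; rewrite eqxx.
by rewrite cnbhds1 cnbhd_card // mul1n addn1.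
Qed.

Lemma stableU1 v I : stable I -> v \in S -> v \notin cnbhds S I ->
  stable (v |: I) /\ #|v |: I| = #|I|.+1.
Proof.
move=> sI vS nv; have sv : stable [set v].
  by apply/stableP => x y; rewrite !inE => /eqP-> /eqP->; rewrite eqxx.
have vI : {in [set v] & I, forall x y, ~~ h x y}.
  move=> x y; rewrite inE => /eqP-> yI; apply: contra nv => hvy.
  by rewrite inE vS; apply/exists_inP; exists y => //; rewrite h_sym.
by have [-> ->] := stable_union vI sv sI; rewrite cards1.
Qed.

(** Adding [v] to [I] must enlarge N[I] by at least q, and N[v] has only q + 1 vertices. *)
Lemma tight_overlap I v : tight I -> v \in S -> v \notin cnbhds S I ->
  #|cnbhd S v :&: cnbhds S I| <= 1.
Proof.
case/and4P=> IS sI I0 /eqP cI vS nv; have [sv cv] := stableU1 sI vS nv.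
have vIS : v |: I \subset S by rewrite subUset sub1set vS.
have := cnbhds_card_ge vIS sv; rewrite cv cnbhdsU1 cardsU cI cnbhd_card //.
have : #|cnbhd S v :&: cnbhds S I| <= #|cnbhd S v|.
  by rewrite subset_leq_card ?subsetIl.
rewrite cnbhd_card // mulSn; lia.
Qed.

Lemma tight_overlap_eq I v x y : tight I -> v \in S -> v \notin cnbhds S I ->
  x \in cnbhd S v -> y \in cnbhd S v ->
  x \in cnbhds S I -> y \in cnbhds S I -> x = y.
Proof.
move=> tI vS nv xv yv xI yI; have /card_le1_eqP := tight_overlap tI vS nv.
by apply; rewrite in_setI ?xv ?yv ?xI ?yI.
Qed.

(** An overlap of exactly one vertex makes N[I] grow by exactly q. *)
Lemma tightU1 I v x : tight I -> v \in S -> v \notin cnbhds S I ->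
  x \in cnbhd S v -> x \in cnbhds S I -> tight (v |: I).
Proof.
move=> tI vS nv xv xI; have ov := tight_overlap tI vS nv.
case/and4P: tI => IS sI I0 /eqP cI; have [sv cv] := stableU1 sI vS nv.
apply/and4P; split; rewrite ?cv //; first by rewrite subUset sub1set vS.
have : 0 < #|cnbhd S v :&: cnbhds S I|.
  by apply/card_gt0P; exists x; rewrite in_setI xv.
rewrite cnbhdsU1 cardsU cI cnbhd_card // mulSn; lia.
Qed.

Lemma common_nbr_uniq u v x y : u \in S -> v \in S -> x \in S -> y \in S ->
  ~~ h u v -> h u x -> h u y -> h v x -> h v y -> x = y.
Proof.
move=> uS vS xS yS uv ux uy vx vy.
by apply: (@tight_overlap_eq [set u] v); rewrite ?tight1 // ?cnbhds1 !inE ?negb_and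
  ?uv ?orbT ?xS ?yS.
Qed.

(* The exits of a maximal tight neighbourhood avoiding c all lie in the clique
   through a, b, c, so stable sets on its two sides can be glued. *)
Lemma no_private_nbr a b c a' :
  a \in S -> b \in S -> c \in S -> a' \in S ->
  a != b -> a != c -> b != c ->
  h a b -> h a c -> h b c -> h a a' -> h b a'.
Proof.
move=> aS bS cS a'S nab nac nbc ab ac bc aa'; apply: contraT => nba'.
(* Otherwise the unrelated vertices [b] and [a'] would share both [a] and [c]. *)
have nca' : ~~ h c a'.
  apply: contraNN nac => ca'; apply/eqP.
  by apply: (@common_nbr_uniq b a') => //; rewrite h_sym.
pose P I := [&& tight I, a' \in I & c \notin cnbhds S I].
have P0 : P [set a'].
  by rewrite /P tight1 // set11 cnbhds1 inE cS h_sym.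
have [I /and3P[tI a'I ncI] maxI] := @arg_maxnP _ [set a'] P (fun I => #|I|) P0.
set X := cnbhds S I in ncI.
have aX : a \in X.
  by rewrite inE aS; apply/exists_inP; exists a' => //; rewrite h_sym.
have a'X : a' \in X.
  by rewrite inE a'S; apply/exists_inP; exists a'.
have onlya x : x \in S -> h c x -> x \in X -> x = a.
  move=> xS cx xX; apply: (tight_overlap_eq tI cS ncI) => //; rewrite inE ?xS ?aS //=.
  by rewrite h_sym.
have nbX : b \notin X.
  by apply: contra nab => /onlya ->//; rewrite h_sym.
pose M := cnbhd S a :&: cnbhd S b.
(* Maximality of [I] relates [u] to [c]. If [u] were unrelated to [b], then N[u] would meet the
   neighbourhood of the tight set [b |: I] in both [x] and [c]. Finally [u] is related to [a], as
   they share [b] and [c]. *)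
have exit u x : u \in S -> u \notin X -> x \in X -> h u x -> u \in M.
  move=> uS nuX xX ux; have xS : x \in S by move: xX; rewrite inE => /andP[].
  have [cu|ncu] := boolP (h c u); last first.
    have /maxI : P (u |: I).
      apply/and3P; split.
      - by apply: (tightU1 tI uS nuX _ xX); rewrite inE xS.
      - by rewrite in_setU a'I orbT.
      - by rewrite cnbhdsU1 in_setU negb_or ncI inE cS h_sym ncu.
    case/and4P: (tI) => _ sI _ _.
    by have [_ ->] := stableU1 sI uS nuX; rewrite /= ltnn.
  have [bu|nbu] := boolP (h b u).
    rewrite !inE uS bu /= andbT; apply: contraT => nau.
    by case/eqP: nbc; apply: (@common_nbr_uniq a u b c) => //; rewrite h_sym.
  have tbI : tight (b |: I) by apply: (tightU1 tI bS nbX _ aX); rewrite inE aS h_sym.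
  suff xc : x = c by move: ncI; rewrite -xc xX.
  apply: (tight_overlap_eq tbI uS).
  - by rewrite cnbhdsU1 in_setU negb_or nuX inE uS nbu.
  - by rewrite inE xS.
  - by rewrite inE cS h_sym.
  - by rewrite cnbhdsU1 in_setU xX orbT.
  - by rewrite cnbhdsU1 in_setU inE cS bc.
case/and4P: (tI) => IS sI I0 /eqP cX; rewrite -/X in cX.
have XS : X \subset S := cnbhds_sub S I.
have Ij : #|I| < j.
  have : #|X| < #|S| by apply: proper_card; apply/properP; split => //; exists b.
  rewrite cX cardS => lt; rewrite ltn_neqAle (stable_card_le IS sI) andbT.
  by apply: contraTneq lt => ->; rewrite ltnn.
have stX : has_stable X #|I|.+1 by apply: (IH Ij XS); rewrite cX addn1.
(* Of the q + 1 vertices of N[a], at least [a] and [a'] lie in [X]. *)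
have cMX : #|M :\: X| < q.
  have sub : M :\: X \subset cnbhd S a :\: [set a; a'].
    apply/subsetP => x; rewrite !inE => /andP[nx /andP[/andP[xS ax] _]].
    rewrite xS ax !andbT /= negb_or; apply/andP; split.
      by apply: contraNN nx => /eqP->; move: aX; rewrite inE.
    by apply: contraNN nx => /eqP->; move: a'X; rewrite inE.
  have := subset_leq_card sub; rewrite (cardsD (cnbhd S a)) cnbhd_card //.
  have /setIidPr -> : [set a; a'] \subset cnbhd S a.
    by rewrite subUset !sub1set !inE aS a'S h_refl.
  have aNa' : a != a' by apply: contraNN nba' => /eqP<-; rewrite h_sym.
  rewrite cards2 aNa'; have : 2 < q.+1; last by clear; lia.
  rewrite -(cnbhd_card aS).
  have /subset_leq_card : a |: (a' |: [set b]) \subset cnbhd S a.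
    by rewrite !subUset !sub1set !inE aS a'S bS ab aa' h_refl.
  rewrite !cardsU1 cards1 !inE negb_or aNa' nab.
  by have -> : a' != b by [apply: contraNN nca' => /eqP->; rewrite h_sym].
have jI : j - #|I| = (j - #|I|.+1).+1 by rewrite subnS prednK // subn_gt0.
(* Removing [X] costs |I| q + 1 vertices and the rest of [M] fewer than q, so more than (j - |I| -
   1) q remain. *)
have stY : has_stable (S :\: (X :|: M)) (j - #|I|.+1).+1.
  apply: IH; rewrite ?subsetDl //; first by rewrite -jI leq_subr.
  rewrite -setDDl cardsD ltn_subRL.
  have /subset_leq_card : (S :\: X) :&: M \subset M :\: X.
    by apply/subsetP => x /setIP[/setDP[_ nx] xM]; apply/setDP.
  have -> : #|S :\: X| = q + (j - #|I|.+1) * q.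
    by rewrite cardsD (setIidPr XS) cX cardS subnDr -mulnBl jI mulSn.
  by rewrite ltn_add2r => /leq_ltn_trans; apply.
case/negP: no_stable.
have -> : j.+1 = #|I|.+1 + (j - #|I|.+1).+1 by rewrite addnS subnKC.
apply: (has_stable_union XS _ _ stX stY); first exact: subsetDl.
move=> x y xX; rewrite in_setD in_setU negb_or => /andP[/andP[nyX nyM] yS].
by apply: contra nyM; rewrite h_sym; exact: exit.
Qed.

Lemma cnbhd_triangle a b c :
  a \in S -> b \in S -> c \in S -> a != b -> a != c -> b != c ->
  h a b -> h a c -> h b c -> cnbhd S a = cnbhd S b.
Proof.
move=> aS bS cS nab nac nbc ab ac bc.
apply/eqP; rewrite eqEcard !cnbhd_card // leqnn andbT.
apply/subsetP => x; rewrite !inE => /andP[xS ax]; rewrite xS.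
exact: (@no_private_nbr a b c x).
Qed.

End Tight.
End StableSets.

(** * Relations without long paths *)

Section PathFree.
Variables (T : finType) (b : rel T).
Implicit Types (S U : {set T}) (s : seq T).
Hypothesis b_refl : reflexive b.
Hypothesis b_sym : symmetric b.

(** Greedy growth at the front only, so that [v] stays on the path: with fewer than [d] vertices it
    cannot cover the closed neighbourhood of its first vertex. *)
Lemma long_path_of_min_degree S d v : v \in S ->
  {in S, forall u, d <= #|cnbhd b S u|} -> forall l, l < d ->
  exists x s, [/\ size s = l, path b x s, uniq (x :: s),
                  {subset x :: s <= S} & v \in x :: s].
Proof.
move=> vS deg; elim=> [_|l IHl ld].
  by exists v, [::]; split; rewrite ?inE // => x; rewrite inE => /eqP->.
have [x [s [ss pxs uxs sub vxs]]] := IHl (ltnW ld).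
have xS : x \in S by apply: sub; rewrite mem_head.
have /subsetPn[u] : ~~ (cnbhd b S x \subset x :: s).
  apply/negP => /subset_leq_card; rewrite (card_uniqP uxs) /= ss.
  by have := deg x xS; lia.
rewrite inE => /andP[uS xu] nu; exists u, (x :: s); split.
- by rewrite /= ss.
- by rewrite /= b_sym xu.
- by rewrite /= nu.
- by move=> y; rewrite inE => /predU1P[->|/sub].
- by rewrite inE vxs orbT.
Qed.

Lemma path_free_min_degree S d :
  (forall s, uniq s -> sorted b s -> size s != d) -> 0 < #|S| -> 0 < d ->
  exists2 v, v \in S & #|cnbhd b S v| < d.
Proof.
move=> nopath /card_gt0P[v vS] d0; apply/exists_inP; apply: contraT.
rewrite negb_exists_in => /forall_inP H.
have [||x [s [ss pxs uxs _ _]]] := @long_path_of_min_degree S d v vS _ d.-1.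
- by move=> u /H; rewrite -leqNgt.
- by rewrite prednK.
- by have := nopath (x :: s) uxs pxs; rewrite /= ss prednK ?eqxx.
Qed.

(* A path on d vertices cannot be prolonged, so its ends see exactly the path;
   it therefore closes up to a cycle, and rotating the cycle makes every vertex
   an end. *)
Lemma path_free_classes S d :
  (forall s, uniq s -> sorted b s -> size s != d.+1) -> 0 < d ->
  {in S, forall v, d <= #|cnbhd b S v|} ->
  {in S, forall v, #|cnbhd b S v| = d /\
                   {in cnbhd b S v, forall u, cnbhd b S u = cnbhd b S v}}.
Proof.
move=> nopath d0 deg v vS.
have full x s : size s = d.-1 -> path b x s -> uniq (x :: s) ->
    {subset x :: s <= S} -> cnbhd b S x = [set y in x :: s].
  move=> ss pxs uxs sub; apply/eqP; rewrite eqEcard; apply/andP; split.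
    apply/subsetP => u; rewrite !inE => /andP[uS xu]; apply: contraT => nu.
    have := nopath (u :: x :: s); rewrite /= b_sym xu pxs ss prednK // eqxx.
    by apply=> //; rewrite /= inE nu.
  rewrite cardsE (card_uniqP uxs) /= ss prednK //.
  by apply: deg; apply: sub; rewrite mem_head.
have [||x [s [ss pxs uxs sub vxs]]] := @long_path_of_min_degree S d v vS _ d.-1.
- exact: deg.
- by rewrite prednK.
have fx := full _ _ ss pxs uxs sub.
have cyc : cycle b (x :: s).
  rewrite /= rcons_path pxs b_sym.
  have : last x s \in cnbhd b S x by rewrite fx inE mem_last.
  by rewrite inE => /andP[].
have all_full u : u \in x :: s -> cnbhd b S u = [set y in x :: s].
  move=> /rot_to[i s' ri]; have mem_rot y : (y \in u :: s') = (y \in x :: s).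
    by rewrite -ri mem_rot.
  have -> : [set y in x :: s] = [set y in u :: s'].
    by apply/setP => y; rewrite !inE -!in_cons mem_rot.
  apply: full.
  - by have := congr1 size ri; rewrite size_rot /= => -[<-].
  - by have := cyc; rewrite -(rot_cycle i) ri /= rcons_path => /andP[].
  - by rewrite -ri rot_uniq.
  - by move=> y; rewrite mem_rot; exact: sub.
rewrite (all_full v vxs); split.
  by rewrite cardsE (card_uniqP uxs) /= ss prednK.
by move=> u; rewrite inE => /all_full.
Qed.

(** The fibres of [cnbhd b S] on [U] are whole classes of [d] vertices. *)
Lemma classes_dvd S U d : U \subset S ->
  {in S, forall v, #|cnbhd b S v| = d /\
                   {in cnbhd b S v, forall u, cnbhd b S u = cnbhd b S v}} ->
  {in U, forall v, cnbhd b S v \subset U} -> d %| #|U|.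
Proof.
move=> /subsetP US cls clo.
have := preim_partitionP (cnbhd b S) U.
move/(@card_uniform_partition _ d) => -> //; first exact: dvdn_mull.
move=> A /imsetP[x xU ->]; have [<- cx] := cls x (US x xU); congr #|pred_of_set _|.
apply/setP => y; rewrite [in LHS]inE; apply/andP/idP.
  by case=> yU /eqP->; rewrite inE US // b_refl.
by move=> yx; rewrite (subsetP (clo x xU) y yx) cx.
Qed.

End PathFree.

(** * Large stable sets by induction *)

Section StableOfPathFree.
Variables (T : finType) (h b : rel T) (d q g : nat).
Hypothesis h_refl : reflexive h.
Hypothesis h_sym : symmetric h.
Hypothesis b_refl : reflexive b.
Hypothesis b_sym : symmetric b.
Hypothesis sub_bh : subrel b h.
Hypothesis deg_h : forall (S : {set T}) v, v \in S ->
  #|cnbhd h S v| < g + #|cnbhd b S v|.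
Hypothesis nopath : forall s, uniq s -> sorted b s -> size s != d.+1.
Hypothesis d_gt0 : 0 < d.
Hypothesis gdq :
  g + d <= q.+1 \/ [/\ 1 < d, g + d <= q.+2 & ~~ (d %| q.+1)].

Lemma has_stable1 (S : {set T}) : 0 < #|S| -> has_stable h S 1.
Proof.
case/card_gt0P=> v vS; apply/has_stableP; exists [set v]; split.
- by rewrite sub1set.
- by apply/stableP => x y; rewrite !inE => /eqP-> /eqP->; rewrite eqxx.
- by rewrite cards1.
Qed.

Lemma has_stable_pick (S : {set T}) v j : v \in S ->
  has_stable h (S :\: cnbhd h S v) j -> has_stable h S j.+1.
Proof.
move=> vS st; rewrite -add1n -(cards1 v); apply: stable_extend => //.
- by rewrite sub1set.
- by apply/stableP => x y; rewrite !inE => /eqP-> /eqP->; rewrite eqxx.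
- by rewrite cnbhds1.
Qed.

Lemma has_stable_regular (S : {set T}) j :
  1 < d -> ~~ (d %| q.+1) ->
  #|S| = j * q + 1 ->
  {in S, forall v, #|cnbhd h S v| <= q.+1} ->
  {in S, forall v, #|cnbhd b S v| = d /\
                   {in cnbhd b S v, forall u, cnbhd b S u = cnbhd b S v}} ->
  (forall i (U : {set T}), i < j -> U \subset S -> i * q < #|U| ->
     has_stable h U i.+1) ->
  has_stable h S j.+1.
Proof.
move=> d1 ndq cS degS cls IH; apply: contraT => nst.
have dS : d %| #|S|.
  by apply: (classes_dvd b_refl _ cls) => // v _; apply/subsetP => x; rewrite inE => /andP[].
have [v vS] : exists v, v \in S by apply/card_gt0P; rewrite cS addn1.
have [d2|d3] := leqP d 2.
  have {d1 d2} d2 : d = 2 by lia.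
  by move: ndq dS; rewrite d2 cS !dvdn2 /= oddD oddM /=; case: (odd q); rewrite ?andbF.
have twin : {in S, forall v, {in cnbhd b S v, forall u, cnbhd h S v = cnbhd h S u}}.
  move=> {v vS} v vS u uv; have [<-//|nvu] := eqVneq v u.
  have [cv ev] := cls v vS.
  (* As d > 2, the blue class of [v] and [u] has a third vertex, which completes an h-triangle. *)
  have : 0 < #|cnbhd b S v :\: [set v; u]|.
    rewrite cardsD cv; have := subset_leq_card (subsetIr (cnbhd b S v) [set v; u]).
    rewrite cards2 nvu; lia.
  case/card_gt0P=> c; rewrite !inE negb_or => /andP[/andP[cv' cu] /andP[cS' bvc]].
  move: uv (ev u uv); rewrite inE => /andP[uS bvu] eu.
  have buc : b u c.
    have : c \in cnbhd b S u by rewrite eu inE cS'.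
    by rewrite inE => /andP[].
  by apply: (cnbhd_triangle h_refl h_sym cS IH degS nst (c := c)); rewrite // 1?eq_sym //;
    exact: sub_bh.
case/negP: ndq.
rewrite -(cnbhd_card h_refl h_sym cS IH degS nst vS).
apply: (classes_dvd b_refl _ cls); first by apply/subsetP => x; rewrite inE => /andP[].
move=> w wv; apply/subsetP => u uw.
move: (wv); rewrite inE => /andP[wS hvw].
have : v \in cnbhd h S w by rewrite inE vS h_sym.
rewrite (twin w wS u uw) inE => /andP[_ huv]; move: uw.
by rewrite !inE h_sym huv => /andP[->].
Qed.

Lemma has_stable_of_path_free j (S : {set T}) : j * q < #|S| -> has_stable h S j.+1.
Proof.
elim/ltn_ind: j S => -[|j] IH S cS; first exact: has_stable1.
have pick v : v \in S -> #|cnbhd h S v| + j * q < #|S| -> has_stable h S j.+2.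
  move=> vS lt; apply: (has_stable_pick vS); apply: IH => //.
  rewrite cardsD (setIidPr _); first by lia.
  by apply/subsetP => x; rewrite inE => /andP[].
rewrite mulSn in cS.
have [v vS vd] : exists2 v, v \in S & #|cnbhd b S v| < d.+1.
  by apply: path_free_min_degree => //; lia.
have [gd|[d1 gd ndq]] := gdq.
  (* The h-neighbourhood of [v] has at most g + d - 1 <= q vertices. *)
  by apply: (pick v vS); have := deg_h vS; lia.
have [/existsP[w /andP[wS wd]]|] := boolP [exists w in S, #|cnbhd b S w| < d].
  by apply: (pick w wS); have := deg_h wS; lia.
rewrite negb_exists_in => /forall_inP big.
have cls := path_free_classes b_sym nopath d_gt0 (S := S).
have {big}cls : {in S, forall v, #|cnbhd b S v| = d /\
    {in cnbhd b S v, forall u, cnbhd b S u = cnbhd b S v}}.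
  by apply: cls => u /big; rewrite -leqNgt.
have degS : {in S, forall u, #|cnbhd h S u| <= q.+1}.
  by move=> u uS; have := deg_h uS; have [-> _] := cls u uS; lia.
(* With one vertex to spare, discarding q + 1 of them is affordable; otherwise |S| is exactly (j +
   1) q + 1. *)
have [lt|ge] := ltnP (j.+1 * q + 1) #|S|.
  by apply: (pick v vS); have := degS v vS; move: lt; rewrite mulSn; lia.
apply: has_stable_regular => //; first by move: ge; rewrite mulSn; lia.
by move=> i U ij _; exact: IH.
Qed.

End StableOfPathFree.

(** * Arithmetic of the degree bound *)

Lemma ceil_div_bounds a c : 0 < c ->
  a <= c * ceil_div a c /\ c * ceil_div a c <= a + c.-1.
Proof.
move=> c0; rewrite /ceil_div; set x := a + c.-1.
have := divn_eq x c; have := ltn_pmod x c0; rewrite mulnC /x; lia.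
Qed.

(* With m = ceil (n / p), either m = d (k + 1) and the bound has room to spare,
   or d k < m < d (k + 1) and d does not divide m. *)
Lemma degree_arith n p d k : 0 < p -> 0 < d -> d <= k + 2 ->
  p * d * k < n <= p * d * (k + 1) ->
  let m := ceil_div n p in let g := ceil_div (k * m) (k + 1) in
  p * m.-1 < n /\
  (g + d <= m.-1.+1 \/ [/\ 1 < d, g + d <= m.-1.+2 & ~~ (d %| m.-1.+1)]).
Proof.
move=> p0 d0 dk /andP[n1 n2] m g.
have [nm mn] := ceil_div_bounds n p0; rewrite -/m in nm mn.
have k1 : 0 < k + 1 by rewrite addn1.
have [_ gm] := ceil_div_bounds (k * m) k1; rewrite -/g addn1 /= in gm.
have m1 : d * k < m.
  by rewrite -(ltn_pmul2l p0) mulnA; exact: leq_trans n1 nm.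
have pm : p * m.-1 < n.
  by have : p * m = p * m.-1 + p by [rewrite -mulnSr prednK //; lia]; lia.
have m2 : m <= d * k.+1.
  rewrite -(prednK (leq_ltn_trans (leq0n _) m1)) -(ltn_pmul2l p0) mulnA -(addn1 k).
  exact: leq_trans pm n2.
split=> //; rewrite prednK; last exact: leq_ltn_trans m1.
have [e|ne] := eqVneq m (d * k.+1).
  (* It remains to see that g <= d k. *)
  left; rewrite e mulnS addnC leq_add2l.
  have : k.+1 * g < k.+1 * (d * k).+1.
    by rewrite mulnS; move: gm; rewrite e; nia.
  by rewrite ltn_pmul2l.
right; have {ne m2} m2 : m < d * k.+1 by rewrite ltn_neqAle ne.
split.
- by move: m2; rewrite mulnS; lia.
(* Since m > d k, the bound g + d >= m + 2 would force d >= k + 3. *)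
- rewrite leqNgt; apply/negP => lt.
  have : k.+1 * (m + 2) <= k.+1 * (g + d) by rewrite leq_pmul2l //; lia.
  by move: m1 gm; rewrite !mulnDr !mulSn mulnS; lia.
- apply/negP => /dvdnP[x mx]; move: m1 m2.
  by rewrite mx mulnC !ltn_pmul2r // [d * _]mulnC !ltn_pmul2r //; lia.
Qed.

(** * Translation to colourings *)

Section Colouring.
Variables (T : finType) (e red : rel T).

Definition not_red_adj : rel T := fun x y => ~~ (e x y && red x y).

Definition blue_adj_or_eq : rel T := fun x y => (x == y) || e x y && ~~ red x y.

Lemma stable_has_red_clique (S : {set T}) i :
  has_stable not_red_adj S i -> has_red_clique e red i.
Proof.
case/has_stableP=> I [_ /stableP sI cI]; exists I; split=> // x y xI yI xy.
by have := sI x y xI yI xy; rewrite negbK.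
Qed.

Lemma path_has_blue_path x s :
  uniq (x :: s) -> path blue_adj_or_eq x s -> has_blue_path e red (size s).+1.
Proof.
move=> us /(pathP x) ps; exists (fun i : 'I_(size s).+1 => nth x (x :: s) i); split.
  by move=> i j /eqP; rewrite nth_uniq // => /eqP; exact: val_inj.
move=> i j ij; have jlt : i < size s by have := ltn_ord j; rewrite [nat_of_ord j]ij.
have := ps i jlt; rewrite [nat_of_ord j]ij /= => /orP[/eqP eq|//].
(* Distinctness rules out the equality clause of [blue_adj_or_eq]. *)
have /= := @nth_uniq _ x (x :: s) i i.+1 (ltn_ord i) jlt us.
by rewrite eq eqxx; lia.
Qed.

(** The non-neighbours of [v], itself included, number at most [g]. The inequality is strict because
    [v] is counted again in its blue closed neighbourhood. *)
Lemma not_red_adj_degree (S : {set T}) v g : irreflexive e ->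
  #|T| - g <= #|nbhd e v| -> v \in S ->
  #|cnbhd not_red_adj S v| < g + #|cnbhd blue_adj_or_eq S v|.
Proof.
move=> irr deg vS.
have vb : v \in cnbhd blue_adj_or_eq S v by rewrite inE vS /blue_adj_or_eq eqxx.
have sub : cnbhd not_red_adj S v \subset
    ~: nbhd e v :|: (cnbhd blue_adj_or_eq S v :\ v).
  apply/subsetP => u; rewrite !inE /not_red_adj /blue_adj_or_eq => /andP[-> nr].
  have [->|] := eqVneq u v; first by rewrite irr.
  by move: nr; case: (e v u) => //= ->; rewrite orbT.
apply: (leq_ltn_trans (subset_leq_card sub)).
have := cardsC (nbhd e v); rewrite (cardsD1 v (cnbhd blue_adj_or_eq S v)) vb cardsU.
lia.
Qed.

End Colouring.

Theorem theorem1p3 (r t k : nat) (T : finType) (e : rel T) :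
  2 <= r -> 2 <= t -> 1 <= k -> t - 3 <= k ->
  simple_graph e ->
  (r - 1) * (t - 1) * k < #|T| <= (r - 1) * (t - 1) * (k + 1) ->
  min_deg_ge e (#|T| - ceil_div (k * ceil_div #|T| (r - 1)) (k + 1)) ->
  arrows e r t.
Proof.
move=> r2 t2 _ tk [sym irr] cT deg red rsym.
have [||| pq gdq] := degree_arith _ _ _ cT; try lia.
have [/existsP[p /andP[up sp]]|nopath] :=
  boolP [exists p : t.-tuple T, uniq p && sorted (blue_adj_or_eq e red) p].
  right; case: p up sp => -[|x s] /= /eqP; first by lia.
  by move=> <-; exact: path_has_blue_path.
left; apply: (@stable_has_red_clique _ _ _ [set: T]);
  rewrite -[r](@subnK 1) ?addn1; last by lia.
(* Used with d = t - 1, so that the excluded paths have t vertices, and with j = r - 1. *)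
apply: (has_stable_of_path_free _ _ _ _ _ _ _ _ gdq (b := blue_adj_or_eq e red)).
- by move=> x; rewrite /not_red_adj irr.
- by move=> x y; rewrite /not_red_adj sym rsym.
- by move=> x; rewrite /blue_adj_or_eq eqxx.
- by move=> x y; rewrite /blue_adj_or_eq eq_sym sym rsym.
- move=> x y; rewrite /blue_adj_or_eq /not_red_adj => /predU1P[->|/andP[_ nr]].
    by rewrite irr.
  by rewrite (negbTE nr) andbF.
- by move=> S v; apply: not_red_adj_degree; [exact: irr | exact: deg].
- move=> s us ss; apply: contraNneq nopath => cs.
  have ts : size s == t by rewrite cs; lia.
  by apply/existsP; exists (Tuple ts); rewrite us.
- by lia.
- by rewrite cardsT.
Qed.
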